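(* Let $a,b>0$ and $\beta$ be real numbers with $0<1-b+a\le 1$ and $\beta\le b-a$, let $c_0\ge a^{\beta}\Gamma(a)/\Gamma(b)$, and let $g$ be completely monotone on $(0,\infty)$. Then the function $$x\mapsto\left[\frac{c_0\,\Gamma(x+b)}{(x+a)^{\beta}\,\Gamma(x+a)}\right]^{g(x)/x}$$ is logarithmically completely monotone on $(0,\infty)$.
   Context: A function $f:I\to\mathbb{R}$ on an interval $I\subseteq\mathbb{R}$ is called completely monotone if it has derivatives of all orders and $(-1)^n f^{(n)}(x)\ge 0$ for all $n=0,1,2,\ldots$ and all $x\in I$. A positive function $f:I\to\mathbb{R}$ is called logarithmically completely monotone if it has derivatives of all orders and $(-1)^n(\log\circ f)^{(n)}(x)\ge 0$ for all $n=1,2,\ldots$ and all $x\in I$. $\Gamma$ is the Gamma function. *)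

(* Defs.v *)
From Stdlib Require Import Reals.
From Coquelicot Require Import Coquelicot.

Open Scope R_scope.

(* Improper Riemann integral at both ends; it converges exactly for x > 0, and
   RInt_gen is an unspecified real elsewhere. *)
Definition Gamma (x : R) : R :=
  RInt_gen (fun t : R => Rpower t (x - 1) * exp (- t))
           (at_right 0) (Rbar_locally p_infty).

(* In the next three definitions the derivatives are two-sided, so I is meant
   to be an open interval. Derive_n is total, hence the separate requirement
   that all derivatives exist. *)
Definition smooth_on (I : R -> Prop) (f : R -> R) : Prop :=
  forall (n : nat) (x : R), I x -> ex_derive_n f n x.

Definition completely_monotone_on (I : R -> Prop) (f : R -> R) : Prop :=
  smooth_on I f /\
  forall (n : nat) (x : R), I x -> 0 <= (-1) ^ n * Derive_n f n x.

Definition log_completely_monotone_on (I : R -> Prop) (f : R -> R) : Prop :=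
  (forall x : R, I x -> 0 < f x) /\
  smooth_on I f /\
  forall (n : nat) (x : R), (1 <= n)%nat -> I x ->
    0 <= (-1) ^ n * Derive_n (fun t : R => ln (f t)) n x.

(* Main.v *)
(* Put s = b - a and F x = ln (c0 Gamma(x+b) / ((x+a)^beta Gamma(x+a))), so that
   the logarithm of the function is g x * (F x / x). Wendel's inequality for Gamma gives
   F' x = sum_k (1/(x+a+k) - 1/(x+a+k+s)) - beta/(x+a), with all derivatives
   taken termwise. Since t -> t^-m is convex and 0 <= s <= 1, each summand of the
   series for (-1)^n F^(n+1) dominates n! s times the telescoping summand with s = 1,
   so the series is at least n! s / (x+a)^(n+1), and F' is completely monotone
   because beta <= s. The bound on c0 says F 0 >= 0; then F x / x is completely monotone,
   as (-1)^n x^(n+1) (F x / x)^(n) is n! F 0 at 0 and has derivative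
   (-1)^n x^n F^(n+1) >= 0. *)
Require Import Defs.
From Stdlib Require Import Reals Lra Lia Factorial.
From Coquelicot Require Import Coquelicot.

Open Scope R_scope.

(** * Elementary inequalities for [exp] and [ln] *)

Lemma exp_le_exp (x y : R) : x <= y -> exp x <= exp y.
Proof.
  intros [H | ->]; [left; now apply exp_increasing | apply Rle_refl].
Qed.

Lemma ln_le_sub_1 (x : R) : 0 < x -> ln x <= x - 1.
Proof.
  intros Hx. generalize (exp_ineq1_le (ln x)). rewrite exp_ln by assumption. lra.
Qed.

Lemma is_derive_Rpower (p x : R) :
  0 < x -> is_derive (fun t => Rpower t p) x (p * Rpower x (p - 1)).
Proof.
  intros Hx. apply is_derive_Reals, derivable_pt_lim_power, Hx.
Qed.

(** * Integrals on the positive half-line *)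

(** Enlarging [[u, v]] only increases the integral of a nonnegative function, so the improper
    integral is the supremum of the proper ones. *)
Lemma is_RInt_gen_of_bounded (f : R -> R) (M : R) :
  (forall x, 0 < x -> 0 <= f x) ->
  (forall x, 0 < x -> continuous f x) ->
  (forall u v, 0 < u -> u <= v -> RInt f u v <= M) ->
  exists l, is_RInt_gen f (at_right 0) (Rbar_locally p_infty) l /\
    forall u v, 0 < u -> u <= v -> RInt f u v <= l.
Proof.
  intros Hpos Hcont HM.
  assert (Hex : forall u v, 0 < u -> 0 < v -> ex_RInt f u v).
  { intros u v Hu Hv. apply (ex_RInt_continuous (V := R_CompleteNormedModule)).
    intros z Hz. apply Hcont. revert Hz.
    apply Rmin_case; apply Rmax_case; lra. }
  set (E := fun z => exists u v, 0 < u /\ u <= v /\ z = RInt f u v).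
  destruct (completeness E) as [l [Hub Hlub]].
  - exists M. intros z (u & v & Hu & Huv & ->). now apply HM.
  - exists (RInt f 1 1), 1, 1. lra.
  - assert (Hle : forall u v, 0 < u -> u <= v -> RInt f u v <= l).
    { intros u v Hu Huv. apply Hub. now exists u, v. }
    exists l. split; [ | exact Hle].
    intros P [eps HP].
    assert (Hnear : exists u v, 0 < u /\ u <= v /\ l - eps < RInt f u v).
    { apply Classical_Prop.NNPP. intros Hn.
      assert (l <= l - eps); [ | generalize (cond_pos eps); lra].
      apply Hlub. intros z (u & v & Hu & Huv & ->).
      apply Rnot_lt_le. intros Hlt. apply Hn. now exists u, v. }
    destruct Hnear as (u & v & Hu & Huv & Hlt).
    (* Every interval containing this [[u, v]] has its integral between [l - eps] and [l]. *)
    apply (Filter_prod _ _ _ (fun x => 0 < x < u) (fun y => v < y)).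
    + exists (mkposreal u Hu). intros x Hx H0. split; [exact H0 | ].
      revert Hx. unfold ball; simpl; unfold AbsRing_ball, abs, minus, plus, opp; simpl.
      intros Hx. apply Rabs_def2 in Hx. lra.
    + exists v. auto.
    + intros x y Hx Hy. exists (RInt f x y). split.
      * apply (RInt_correct (V := R_CompleteNormedModule)), Hex; lra.
      * apply HP. unfold ball; simpl; unfold AbsRing_ball, abs, minus, plus, opp; simpl.
        assert (RInt f x y <= l) by (apply Hle; lra).
        assert (RInt f u v <= RInt f x y).
        { rewrite <- (RInt_Chasles f x u y) by (apply Hex; lra).
          rewrite <- (RInt_Chasles f u v y) by (apply Hex; lra).
          assert (0 <= RInt f x u).
          { apply RInt_ge_0; [lra | apply Hex; lra | ]. intros; apply Hpos; lra. }
          assert (0 <= RInt f v y).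
          { apply RInt_ge_0; [lra | apply Hex; lra | ]. intros; apply Hpos; lra. }
          unfold plus; simpl. lra. }
        apply Rabs_def1; lra.
Qed.

Lemma is_RInt_gen_ge_0 (f : R -> R) (l : R) :
  (forall x, 0 < x -> 0 <= f x) ->
  is_RInt_gen f (at_right 0) (Rbar_locally p_infty) l -> 0 <= l.
Proof.
  intros Hpos Hf. apply Rnot_lt_le. intros Hl.
  assert (He : 0 < - l) by lra.
  destruct (Hf (ball l (mkposreal _ He)) (locally_ball l _)) as [Q S HQ [M HM] HQS].
  destruct HQ as [d Hd].
  (* Taking [u <= 1 <= v] keeps the endpoints in order, as positivity of the integral requires. *)
  assert (Hd' : 0 < Rmin (d / 2) 1 /\ Rmin (d / 2) 1 <= 1 /\ Rmin (d / 2) 1 < d).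
  { generalize (cond_pos d). apply Rmin_case_strong; lra. }
  set (u := Rmin (d / 2) 1) in *. set (v := Rmax 1 (M + 1)).
  assert (Hv : 1 <= v /\ M < v).
  { unfold v. apply Rmax_case_strong; lra. }
  destruct (HQS u v) as (z & Hz & Hb).
  - apply Hd; [ | lra].
    unfold ball; simpl; unfold AbsRing_ball, abs, minus, plus, opp; simpl.
    apply Rabs_def1; lra.
  - apply HM; lra.
  - simpl in Hz.
    assert (0 <= z).
    { apply (is_RInt_ge_0 f u v); [lra | exact Hz | ]. intros; apply Hpos; lra. }
    revert Hb. unfold ball; simpl; unfold AbsRing_ball, abs, minus, plus, opp; simpl.
    intros Hb. apply Rabs_def2 in Hb. lra.
Qed.

Lemma is_RInt_gen_le (f g : R -> R) (lf lg : R) :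
  (forall x, 0 < x -> f x <= g x) ->
  is_RInt_gen f (at_right 0) (Rbar_locally p_infty) lf ->
  is_RInt_gen g (at_right 0) (Rbar_locally p_infty) lg -> lf <= lg.
Proof.
  intros Hle Hf Hg.
  cut (0 <= lg - lf); [lra | ].
  apply (is_RInt_gen_ge_0 (fun x => g x - f x)).
  - intros x Hx. generalize (Hle x Hx). lra.
  - exact (is_RInt_gen_minus (V := R_NormedModule) g f lg lf Hg Hf).
Qed.

(** * The Gamma function *)

Definition gamma_integrand (x t : R) : R := Rpower t (x - 1) * exp (- t).

Lemma gamma_integrand_pos (x t : R) : 0 < gamma_integrand x t.
Proof. apply Rmult_lt_0_compat; apply exp_pos. Qed.

Lemma is_derive_gamma_integrand (x t : R) :
  0 < t ->
  is_derive (gamma_integrand x) t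
    ((x - 1) * gamma_integrand (x - 1) t - gamma_integrand x t).
Proof.
  intros Ht. unfold gamma_integrand.
  assert (H := is_derive_Rpower (x - 1) t Ht).
  assert (He : is_derive (fun t => exp (- t)) t (- exp (- t))).
  { auto_derive; auto; ring. }
  generalize (is_derive_mult _ _ _ _ _ H He Rmult_comm).
  intros K. evar_last. exact K. unfold plus, mult; simpl. ring.
Qed.

Lemma continuous_gamma_integrand (x t : R) :
  0 < t -> continuous (gamma_integrand x) t.
Proof.
  intros Ht. apply (ex_derive_continuous (V := R_NormedModule)).
  eexists. apply is_derive_gamma_integrand, Ht.
Qed.

(* Since [ln u <= u / p - 1 + ln p], the maximum of [p * ln u - u] is at [u = p]. *)
Lemma Rpower_exp_bound (p u : R) :
  0 < p -> 0 < u -> Rpower u p * exp (- u) <= exp (p * ln p - p).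
Proof.
  intros Hp Hu. unfold Rpower. rewrite <- exp_plus.
  assert (p * ln u <= u - p + p * ln p).
  { replace (ln u) with (ln (u / p) + ln p) by (rewrite ln_div by assumption; ring).
    assert (H : ln (u / p) <= u / p - 1).
    { apply ln_le_sub_1, Rdiv_lt_0_compat; assumption. }
    apply (Rmult_le_compat_l p) in H; [ | lra].
    replace (p * (u / p - 1)) with (u - p) in H by (field; lra). lra. }
  apply exp_le_exp. lra.
Qed.

(** The majorant behaves like [t^(x-1)] near 0 and like [t^-2] at infinity, and it has an elementary
    primitive, a multiple of [Rpower (t / (1 + t)) x]; both ends are thus handled at once. *)
Lemma gamma_integrand_bound (x : R) :
  0 < x ->
  exists C, 0 < C /\ forall t, 0 < t ->
    gamma_integrand x t <= C * (Rpower (t / (1 + t)) (x - 1) / (1 + t) ^ 2).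
Proof.
  intros Hx. set (p := x + 1).
  (* The first factor bounds [Rpower (1 + t) p * exp (- (1 + t))]; the second comes from
     [exp (- t) = exp 1 * exp (- (1 + t))]. *)
  exists (exp (p * ln p - p) * exp 1).
  split; [apply Rmult_lt_0_compat; apply exp_pos | ].
  intros t Ht. unfold gamma_integrand.
  assert (H := Rpower_exp_bound p (1 + t) ltac:(unfold p; lra) ltac:(lra)).
  replace (- t) with (1 + - (1 + t)) by ring. rewrite exp_plus.
  assert (Hd : Rpower (t / (1 + t)) (x - 1) * Rpower (1 + t) (x - 1) = Rpower t (x - 1)).
  { rewrite Rpower_mult_distr; [f_equal; field; lra | apply Rdiv_lt_0_compat; lra | lra]. }
  assert (Hs : Rpower (1 + t) p = Rpower (1 + t) (x - 1) * (1 + t) ^ 2).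
  { rewrite <- (Rpower_pow 2) by lra. rewrite <- Rpower_plus. f_equal. unfold p; simpl; ring. }
  rewrite <- Hd. rewrite Hs in H.
  set (A := Rpower (t / (1 + t)) (x - 1)) in *.
  assert (HA : 0 < A) by apply exp_pos.
  set (B := Rpower (1 + t) (x - 1)) in *.
  assert (Hq : 0 < (1 + t) ^ 2) by (apply pow_lt; lra).
  apply Rmult_le_reg_r with (1 := Hq).
  replace (exp (p * ln p - p) * exp 1 * (A / (1 + t) ^ 2) * (1 + t) ^ 2)
    with (exp 1 * A * exp (p * ln p - p)) by (field; lra).
  replace (A * B * (exp 1 * exp (- (1 + t))) * (1 + t) ^ 2)
    with (exp 1 * A * (B * (1 + t) ^ 2 * exp (- (1 + t)))) by ring.
  apply Rmult_le_compat_l; [ | exact H].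
  apply Rmult_le_pos; [left; apply exp_pos | lra].
Qed.

Lemma RInt_gamma_integrand_bounded (x : R) :
  0 < x ->
  exists M, forall u v, 0 < u -> u <= v -> RInt (gamma_integrand x) u v <= M.
Proof.
  intros Hx. destruct (gamma_integrand_bound x Hx) as (C & HC & Hb).
  exists (C / x). intros u v Hu Huv.
  (* [G] is a primitive of the majorant with values in [(0, C / x]] for [t > 0], so its increments
     are at most [C / x]. *)
  set (G := fun t => C / x * Rpower (t / (1 + t)) x).
  set (dG := fun t => C * (Rpower (t / (1 + t)) (x - 1) / (1 + t) ^ 2)).
  assert (Hder : forall t, 0 < t -> is_derive G t (dG t)).
  { intros t Ht. unfold G, dG.
    assert (H1 : is_derive (fun t => t / (1 + t)) t (/ (1 + t) ^ 2)).
    { auto_derive; [lra | field; lra]. }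
    assert (H2 := is_derive_comp (fun y => Rpower y x) (fun t => t / (1 + t)) t _ _
      (is_derive_Rpower x (t / (1 + t)) ltac:(apply Rdiv_lt_0_compat; lra)) H1).
    apply (is_derive_scal _ _ (C / x)) in H2.
    evar_last. exact H2. unfold scal; simpl; unfold mult; simpl. field. lra. }
  assert (Hcont : forall t, 0 < t -> continuous dG t).
  { intros t Ht. apply (ex_derive_continuous (V := R_NormedModule)).
    unfold dG, Rpower. auto_derive. repeat split; trivial; try lra.
    - apply Rdiv_lt_0_compat; lra.
    - apply Rgt_not_eq. nra. }
  assert (HI : is_RInt dG u v (G v - G u)).
  { apply (is_RInt_derive (V := R_CompleteNormedModule)); rewrite Rmin_left, Rmax_right by lra.
    - intros; apply Hder; lra.
    - intros; apply Hcont; lra. }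
  apply Rle_trans with (RInt dG u v).
  - apply RInt_le; [lra | | eexists; exact HI | ].
    + apply (ex_RInt_continuous (V := R_CompleteNormedModule)).
      rewrite Rmin_left, Rmax_right by lra.
      intros; apply continuous_gamma_integrand; lra.
    + intros t Ht. apply Hb. lra.
  - rewrite (is_RInt_unique _ _ _ _ HI). unfold G.
    assert (HCx : 0 < C / x) by (apply Rdiv_lt_0_compat; lra).
    assert (Rpower (v / (1 + v)) x <= 1).
    { apply Rle_trans with (exp 0); [ | rewrite exp_0; lra]. apply exp_le_exp.
      assert (ln (v / (1 + v)) <= 0); [ | nra].
      apply Rle_trans with (v / (1 + v) - 1).
      - apply ln_le_sub_1, Rdiv_lt_0_compat; lra.
      - replace (v / (1 + v) - 1) with (- / (1 + v)) by (field; lra).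
        assert (0 < / (1 + v)) by (apply Rinv_0_lt_compat; lra). lra. }
    assert (0 < Rpower (u / (1 + u)) x) by apply exp_pos.
    nra.
Qed.

Lemma is_RInt_gen_Gamma (x : R) :
  0 < x ->
  is_RInt_gen (gamma_integrand x) (at_right 0) (Rbar_locally p_infty) (Gamma x)
  /\ 0 < Gamma x.
Proof.
  intros Hx. destruct (RInt_gamma_integrand_bounded x Hx) as [M HM].
  destruct (is_RInt_gen_of_bounded (gamma_integrand x) M) as (l & Hl & Hle); trivial.
  - intros t _. left. apply gamma_integrand_pos.
  - apply continuous_gamma_integrand.
  - assert (E : Gamma x = l).
    { apply (is_RInt_gen_unique (V := R_CompleteNormedModule) _ _ Hl). }
    rewrite E. split; [exact Hl | ].
    apply Rlt_le_trans with (RInt (gamma_integrand x) 1 2); [ | apply Hle; lra].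
    apply RInt_gt_0; [lra | intros; apply gamma_integrand_pos | ].
    intros; apply continuous_gamma_integrand; lra.
Qed.

Lemma Gamma_pos (x : R) : 0 < x -> 0 < Gamma x.
Proof. apply is_RInt_gen_Gamma. Qed.

Lemma filterlim_gamma_integrand_0 (x : R) :
  1 < x -> filterlim (gamma_integrand x) (at_right 0) (locally 0).
Proof.
  intros Hx P [eps HP].
  (* With this radius, [Rpower d (x - 1) = eps]. *)
  set (d := Rpower eps (/ (x - 1))).
  assert (Hd : 0 < d) by apply exp_pos.
  exists (mkposreal d Hd). intros t Ht Ht0. apply HP.
  revert Ht. unfold ball; simpl; unfold AbsRing_ball, abs, minus, plus, opp; simpl.
  intros Ht. apply Rabs_def2 in Ht.
  assert (Hp := gamma_integrand_pos x t).
  rewrite Rabs_pos_eq by lra.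
  assert (Rpower t (x - 1) < eps).
  { apply Rlt_le_trans with (Rpower d (x - 1)).
    - apply Rlt_Rpower_l; lra.
    - unfold d. rewrite Rpower_mult, Rinv_l, Rpower_1 by (try lra; apply cond_pos). lra. }
  assert (exp (- t) < 1) by (rewrite <- exp_0; apply exp_increasing; lra).
  assert (0 < Rpower t (x - 1)) by apply exp_pos.
  unfold gamma_integrand. generalize (exp_pos (- t)). nra.
Qed.

Lemma filterlim_gamma_integrand_infty (x : R) :
  1 < x -> filterlim (gamma_integrand x) (Rbar_locally p_infty) (locally 0).
Proof.
  intros Hx P [eps HP].
  (* [K] bounds [t * gamma_integrand x t], so the integrand is at most [K / t], which is below [eps]
     once [t > K / eps]. *)
  set (K := exp (x * ln x - x)).
  assert (HK : 0 < K) by apply exp_pos.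
  exists (K / eps). intros t Ht. apply HP.
  assert (Heps := cond_pos eps).
  assert (H0 : 0 < K / eps) by (apply Rdiv_lt_0_compat; lra).
  unfold ball; simpl; unfold AbsRing_ball, abs, minus, plus, opp; simpl.
  assert (Hp := gamma_integrand_pos x t).
  rewrite Ropp_0, Rplus_0_r, Rabs_pos_eq by lra.
  assert (H := Rpower_exp_bound x t ltac:(lra) ltac:(lra)). fold K in H.
  replace x with ((x - 1) + 1) in H at 1 by ring.
  rewrite Rpower_plus, Rpower_1 in H by lra.
  assert (K < t * eps).
  { apply (Rmult_lt_compat_r eps) in Ht; [ | lra].
    replace (K / eps * eps) with K in Ht by (field; lra). lra. }
  apply Rmult_lt_reg_l with t; [lra | ].
  unfold gamma_integrand. lra.
Qed.

(** Integration by parts: the integral of the derivative of [gamma_integrand (x + 1)] is 0 by its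
    boundary values, and [x * Gamma x - Gamma (x + 1)] by the formula for that derivative. *)
Lemma Gamma_succ (x : R) : 0 < x -> Gamma (x + 1) = x * Gamma x.
Proof.
  intros Hx.
  destruct (is_RInt_gen_Gamma x Hx) as [H1 _].
  destruct (is_RInt_gen_Gamma (x + 1) ltac:(lra)) as [H2 _].
  assert (Hord : filter_prod (at_right 0) (Rbar_locally p_infty)
    (fun ab : R * R => 0 < fst ab /\ fst ab < snd ab)).
  { apply (Filter_prod _ _ _ (fun u => 0 < u < 1) (fun v => 1 < v)).
    - exists (mkposreal 1 Rlt_0_1). intros y Hy H0. revert Hy.
      unfold ball; simpl; unfold AbsRing_ball, abs, minus, plus, opp; simpl.
      intros Hy. apply Rabs_def2 in Hy. lra.
    - exists 1. auto.
    - simpl. intros; lra. }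
  assert (HD : forall t, 0 < t -> Derive (gamma_integrand (x + 1)) t
     = x * gamma_integrand x t - gamma_integrand (x + 1) t).
  { intros t Ht. apply is_derive_unique.
    evar_last. apply is_derive_gamma_integrand, Ht.
    replace (x + 1 - 1) with x by ring. reflexivity. }
  assert (K : is_RInt_gen (Derive (gamma_integrand (x + 1)))
    (at_right 0) (Rbar_locally p_infty) (0 - 0)).
  { apply is_RInt_gen_Derive.
    - revert Hord. apply filter_imp. intros [u v] [Hu Huv] t Ht; simpl in *.
      rewrite Rmin_left in Ht by lra.
      eexists. apply is_derive_gamma_integrand. lra.
    - revert Hord. apply filter_imp. intros [u v] [Hu Huv] t Ht; simpl in *.
      rewrite Rmin_left in Ht by lra.
      (* The closed form of [Derive] is known only at positive points, so continuity is transferred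
         from a function that agrees with it near [t]. *)
      apply continuous_ext_loc with
        (fun t => x * gamma_integrand x t - gamma_integrand (x + 1) t).
      + assert (Ht0 : 0 < t) by lra.
        exists (mkposreal t Ht0). intros y Hy. symmetry. apply HD. revert Hy.
        unfold ball; simpl; unfold AbsRing_ball, abs, minus, plus, opp; simpl.
        intros Hy. apply Rabs_def2 in Hy. lra.
      + apply (continuous_minus (V := R_NormedModule)).
        * apply (continuous_scal_r (V := R_NormedModule)).
          apply continuous_gamma_integrand; lra.
        * apply continuous_gamma_integrand; lra.
    - apply filterlim_gamma_integrand_0; lra.
    - apply filterlim_gamma_integrand_infty; lra. }
  assert (K' : is_RInt_gen (Derive (gamma_integrand (x + 1)))
    (at_right 0) (Rbar_locally p_infty) (x * Gamma x - Gamma (x + 1))).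
  { apply (is_RInt_gen_ext (V := R_NormedModule)) with
      (fun t => x * gamma_integrand x t - gamma_integrand (x + 1) t).
    - revert Hord. apply filter_imp. intros [u v] [Hu Huv] t Ht; simpl in *.
      rewrite Rmin_left in Ht by lra. symmetry. apply HD. lra.
    - apply (is_RInt_gen_minus (V := R_NormedModule)); [ | exact H2].
      apply (is_RInt_gen_scal (V := R_NormedModule)), H1. }
  apply (is_RInt_gen_unique (V := R_CompleteNormedModule)) in K.
  apply (is_RInt_gen_unique (V := R_CompleteNormedModule)) in K'.
  lra.
Qed.

(* Young's inequality [(t / z)^s <= (1 - s) + s * t / z], integrated against
   [t^(z-1) exp (-t)]. *)
Lemma Gamma_Wendel (z s : R) :
  0 < z -> 0 <= s <= 1 -> Gamma (z + s) <= Rpower z s * Gamma z.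
Proof.
  intros Hz Hs.
  destruct (is_RInt_gen_Gamma z Hz) as [H1 _].
  destruct (is_RInt_gen_Gamma (z + 1) ltac:(lra)) as [H2 _].
  destruct (is_RInt_gen_Gamma (z + s) ltac:(lra)) as [H3 _].
  (* These weights make the integrated right-hand side of Young's inequality a combination of
     [Gamma z] and [Gamma (z + 1) = z * Gamma z]. *)
  apply (is_RInt_gen_scal (V := R_NormedModule) _ (Rpower z s * (1 - s))) in H1.
  apply (is_RInt_gen_scal (V := R_NormedModule) _ (Rpower z s * (s / z))) in H2.
  assert (H4 := is_RInt_gen_plus (V := R_NormedModule) _ _ _ _ H1 H2).
  assert (HH := fun h => is_RInt_gen_le _ _ _ _ h H3 H4).
  unfold plus, scal in HH; simpl in HH; unfold mult in HH; simpl in HH.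
  rewrite (Gamma_succ z Hz) in HH.
  replace (Rpower z s * Gamma z)
    with (Rpower z s * (1 - s) * Gamma z + Rpower z s * (s / z) * (z * Gamma z))
    by (field; lra).
  apply HH. intros t Ht. unfold gamma_integrand.
  replace (z + s - 1) with (s + (z - 1)) by ring.
  replace (z + 1 - 1) with (1 + (z - 1)) by ring.
  rewrite !Rpower_plus, (Rpower_1 t Ht).
  assert (Htz : 0 < t / z) by (apply Rdiv_lt_0_compat; lra).
  (* Weighted means of [t / z] and 1: with [m] the arithmetic one, [ln w <= w - 1] is taken at
     [t / z / m] and at [1 / m], with weights [s] and [1 - s]; the right-hand sides then cancel. *)
  assert (Y : Rpower (t / z) s <= (1 - s) + s * (t / z)).
  { assert (Hm : 0 < (1 - s) + s * (t / z)).
    { destruct (Rle_lt_or_eq_dec s 1) as [Hs1 | ->]; [lra | nra | lra]. }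
    set (m := (1 - s) + s * (t / z)) in *.
    assert (Ha := ln_le_sub_1 (t / z / m) ltac:(apply Rdiv_lt_0_compat; lra)).
    assert (Hb := ln_le_sub_1 (1 / m) ltac:(apply Rdiv_lt_0_compat; lra)).
    rewrite ln_div in Ha, Hb by lra. rewrite ln_1 in Hb.
    assert (Hc : s * (t / z / m - 1) + (1 - s) * (1 / m - 1) = 0).
    { unfold m. field. fold m. unfold m in Hm.
      split; [lra | ]. intros E0.
      assert (((1 - s) + s * (t / z)) * z = 0) by (rewrite <- E0; field; lra). nra. }
    assert (s * ln (t / z) <= ln m) by nra.
    rewrite <- (exp_ln m Hm). now apply exp_le_exp. }
  assert (E : Rpower t s = Rpower z s * Rpower (t / z) s).
  { rewrite Rpower_mult_distr by lra. f_equal. field. lra. }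
  rewrite E.
  assert (0 < Rpower z s * Rpower t (z - 1) * exp (- t)).
  { repeat apply Rmult_lt_0_compat; apply exp_pos. }
  replace (Rpower z s * Rpower (t / z) s * Rpower t (z - 1) * exp (- t))
    with (Rpower z s * Rpower t (z - 1) * exp (- t) * Rpower (t / z) s) by ring.
  replace (Rpower z s * (1 - s) * (Rpower t (z - 1) * exp (- t)) +
    Rpower z s * (s / z) * (t * Rpower t (z - 1) * exp (- t)))
    with (Rpower z s * Rpower t (z - 1) * exp (- t) * ((1 - s) + s * (t / z)))
    by (field; lra).
  apply Rmult_le_compat_l; lra.
Qed.
(** * Ratios of Gamma functions *)

(** For [m = n + 1] this is [(-1)^n / n!] times the n-th derivative of [1/t - 1/(t+s)] in [t]. *)
Definition inv_pow_gap (m : nat) (s t : R) : R := / t ^ m - / (t + s) ^ m.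

Lemma inv_pow_antitone (m : nat) (t u : R) : 0 < t <= u -> / u ^ m <= / t ^ m.
Proof.
  intros Htu. apply Rinv_le_contravar; [apply pow_lt; lra | apply pow_incr; lra].
Qed.

Lemma inv_pow_gap_ge_0 (m : nat) (s t : R) : 0 <= s -> 0 < t -> 0 <= inv_pow_gap m s t.
Proof.
  intros Hs Ht. unfold inv_pow_gap.
  generalize (inv_pow_antitone m t (t + s) ltac:(lra)). lra.
Qed.

Lemma inv_pow_gap_le (m : nat) (s t : R) :
  0 <= s <= 1 -> 0 < t -> inv_pow_gap m s t <= inv_pow_gap m 1 t.
Proof.
  intros Hs Ht. unfold inv_pow_gap.
  generalize (inv_pow_antitone m (t + s) (t + 1) ltac:(lra)). lra.
Qed.

(* Convexity of [t ^ -m], obtained by multiplying the case [m = 1] by itself: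
   Chebyshev's sum inequality keeps the form of the bound. *)
Lemma inv_pow_gap_concave (m : nat) (s t : R) :
  0 <= s <= 1 -> 0 < t -> s * inv_pow_gap m 1 t <= inv_pow_gap m s t.
Proof.
  intros Hs Ht. unfold inv_pow_gap. rewrite <- !pow_inv.
  set (u := / t). set (v := / (t + 1)). set (w := / (t + s)).
  assert (Hv : 0 < v) by (apply Rinv_0_lt_compat; lra).
  assert (Hw : 0 < w) by (apply Rinv_0_lt_compat; lra).
  assert (Huv : v <= u) by (apply Rinv_le_contravar; lra).
  assert (H1 : w <= (1 - s) * u + s * v).
  { assert (E : (1 - s) * u + s * v - w = s * (1 - s) * (u * v * w)).
    { unfold u, v, w. field. lra. }
    assert (0 <= s * (1 - s) * (u * v * w)); [ | lra].
    repeat apply Rmult_le_pos; lra. }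
  cut (w ^ m <= (1 - s) * u ^ m + s * v ^ m); [lra | ].
  induction m as [ | m IH]; simpl; [lra | ].
  assert (Hm : v ^ m <= u ^ m) by (apply pow_incr; lra).
  apply Rle_trans with (((1 - s) * u + s * v) * ((1 - s) * u ^ m + s * v ^ m)).
  - apply Rmult_le_compat; try lra. apply pow_le; lra.
  - assert (0 <= s * (1 - s) * ((u - v) * (u ^ m - v ^ m))); [ | lra].
    repeat apply Rmult_le_pos; lra.
Qed.

(** The sum telescopes; the case [s = 1] is the comparison series for upper and lower bounds
    alike. *)
Lemma sum_inv_pow_gap_1 (m N : nat) (y : R) :
  sum_n (fun k => inv_pow_gap m 1 (y + INR k)) N = / y ^ m - / (y + INR (S N)) ^ m.
Proof.
  induction N as [ | N IH].
  - rewrite sum_O. unfold inv_pow_gap. simpl INR. now rewrite Rplus_0_r.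
  - rewrite sum_Sn, IH. unfold inv_pow_gap, plus; cbn [AbelianMonoid.plus].
    rewrite (S_INR (S N)). simpl. rewrite Rplus_assoc. ring.
Qed.

(** * Series of gaps and their termwise differentiation *)

Definition gap_sum (m : nat) (s : R) (N : nat) (y : R) : R :=
  sum_n (fun k => inv_pow_gap m s (y + INR k)) N.

(** For [m = 1] this is [psi(y+s) - psi(y)], with [psi] the logarithmic derivative of Gamma; larger
    [m] give its derivatives up to sign and factorial. The limit is finite for [0 <= s <= 1] and
    [0 < y], by [is_lim_gap_sum]. *)
Definition gap_series (m : nat) (s y : R) : R := real (Lim_seq (fun N => gap_sum m s N y)).

(** The base is at least 1, so the power can be lowered to 1. The bound does not involve [y], and
    this uniformity is what later permits differentiating limits. *)
Lemma inv_pow_shift_le (m N : nat) (y : R) :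
  0 < y -> 0 <= / (y + INR (S N)) ^ S m <= / INR (S N).
Proof.
  intros Hy. assert (H1 : 1 <= INR (S N)) by (rewrite S_INR; generalize (pos_INR N); lra).
  split.
  - left. apply Rinv_0_lt_compat, pow_lt. lra.
  - apply Rinv_le_contravar; [lra | ].
    apply Rle_trans with ((y + INR (S N)) ^ 1); [simpl; lra | ].
    apply Rle_pow; [lra | lia].
Qed.

Lemma is_lim_seq_inv_S : is_lim_seq (fun N => / INR (S N)) 0.
Proof.
  apply (is_lim_seq_incr_1 (fun N => / INR N)).
  apply (is_lim_seq_inv _ p_infty); [apply is_lim_seq_INR | discriminate].
Qed.

Lemma is_lim_seq_inv_pow_shift (m : nat) (y : R) :
  0 < y -> is_lim_seq (fun N => / (y + INR (S N)) ^ S m) 0.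
Proof.
  intros Hy. apply is_lim_seq_le_le with (fun _ => 0) (fun N => / INR (S N)).
  - intros N. now apply inv_pow_shift_le.
  - apply is_lim_seq_const.
  - apply is_lim_seq_inv_S.
Qed.

Lemma gap_sum_S (m : nat) (s : R) (N : nat) (y : R) :
  gap_sum m s (S N) y = gap_sum m s N y + inv_pow_gap m s (y + INR (S N)).
Proof. unfold gap_sum. now rewrite sum_Sn. Qed.

Section GapSeries.

Variables (s : R) (Hs : 0 <= s <= 1).

Lemma gap_sum_incr (m N : nat) (y : R) :
  0 < y -> gap_sum m s N y <= gap_sum m s (S N) y.
Proof.
  intros Hy. rewrite gap_sum_S.
  assert (0 <= inv_pow_gap m s (y + INR (S N))); [ | lra].
  apply inv_pow_gap_ge_0; [lra | generalize (pos_INR (S N)); lra].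
Qed.

Lemma gap_sum_le (m N : nat) (y : R) : 0 < y -> gap_sum m s N y <= / y ^ m.
Proof.
  intros Hy. apply Rle_trans with (/ y ^ m - / (y + INR (S N)) ^ m).
  - rewrite <- sum_inv_pow_gap_1. apply sum_n_m_le. intros k.
    apply inv_pow_gap_le; [lra | generalize (pos_INR k); lra].
  - assert (0 < / (y + INR (S N)) ^ m); [ | lra].
    apply Rinv_0_lt_compat, pow_lt. generalize (pos_INR (S N)); lra.
Qed.

Lemma is_lim_gap_sum (m : nat) (y : R) :
  0 < y -> is_lim_seq (fun N => gap_sum m s N y) (gap_series m s y).
Proof.
  intros Hy. apply Lim_seq_correct'.
  apply ex_finite_lim_seq_incr with (/ y ^ m).
  - intros N. now apply gap_sum_incr.
  - intros N. now apply gap_sum_le.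
Qed.

(** The omitted terms are dominated by the telescoping ones with [s = 1], whose sum is
    [/ (y + INR (S N)) ^ S m]. Hence the partial sums increase to the series, while the partial sums
    plus this remainder decrease to it. *)
Lemma gap_series_tail (m N : nat) (y : R) :
  0 < y -> Rabs (gap_series (S m) s y - gap_sum (S m) s N y) <= / INR (S N).
Proof.
  intros Hy. assert (HL := is_lim_gap_sum (S m) y Hy).
  assert (H1 : gap_sum (S m) s N y <= gap_series (S m) s y).
  { apply (is_lim_seq_incr_compare _ _ HL). intros; now apply gap_sum_incr. }
  set (v := fun N => gap_sum (S m) s N y + / (y + INR (S N)) ^ S m).
  assert (H2 : gap_series (S m) s y <= v N).
  { apply (is_lim_seq_decr_compare v).
    - replace (Finite (gap_series (S m) s y))
        with (Rbar_plus (gap_series (S m) s y) 0) by (simpl; f_equal; ring).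
      apply is_lim_seq_plus with (1 := HL) (2 := is_lim_seq_inv_pow_shift m y Hy).
      reflexivity.
    - intros k. unfold v. rewrite gap_sum_S.
      assert (Hk := pos_INR (S k)).
      assert (H := inv_pow_gap_le (S m) s (y + INR (S k)) Hs ltac:(lra)).
      revert H. unfold inv_pow_gap at 2. rewrite (S_INR (S k)), Rplus_assoc.
      lra. }
  generalize (inv_pow_shift_le m N y Hy). unfold v in H2.
  intros H3. apply Rabs_le. lra.
Qed.

Lemma gap_series_lower (m : nat) (y : R) :
  0 < y -> s * / y ^ S m <= gap_series (S m) s y.
Proof.
  intros Hy.
  change (Rbar_le (s * / y ^ S m) (gap_series (S m) s y)).
  apply is_lim_seq_le with
    (fun N => s * (/ y ^ S m - / (y + INR (S N)) ^ S m)) (fun N => gap_sum (S m) s N y).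
  - intros N. rewrite <- sum_inv_pow_gap_1, <- (sum_n_mult_l (K := R_Ring)).
    apply sum_n_m_le. intros k. apply inv_pow_gap_concave; [lra | ].
    generalize (pos_INR k); lra.
  - replace (Finite (s * / y ^ S m)) with (Rbar_mult s (Finite (/ y ^ S m - 0)))
      by (simpl; f_equal; ring).
    apply is_lim_seq_scal_l. apply is_lim_seq_minus'; [apply is_lim_seq_const | ].
    now apply is_lim_seq_inv_pow_shift.
  - now apply is_lim_gap_sum.
Qed.

Lemma is_derive_gap_sum (m N : nat) (y : R) :
  0 < y -> is_derive (gap_sum m s N) y (- INR m * gap_sum (S m) s N y).
Proof.
  intros Hy.
  assert (Hk : forall k, is_derive (fun y => inv_pow_gap m s (y + INR k)) y
    (- INR m * inv_pow_gap (S m) s (y + INR k))).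
  { intros k. assert (H := pos_INR k). unfold inv_pow_gap.
    assert (P : forall c, 0 <= c -> is_derive (fun y => / (y + c) ^ m) y
       (- INR m * / (y + c) ^ S m)).
    { intros c Hc.
      assert (Hn : y + c <> 0) by lra.
      apply is_derive_ext with (fun y => (/ (y + c)) ^ m); [intros; apply pow_inv | ].
      assert (Hi : is_derive (fun y => / (y + c)) y (- / (y + c) ^ 2)).
      { auto_derive; [exact Hn | field; exact Hn]. }
      evar_last. apply is_derive_pow, Hi. unfold Rdiv. rewrite Ropp_mult_distr_l_reverse.
      destruct m as [ | m]; [simpl; ring | ].
      simpl pred. rewrite <- !pow_inv. set (i := / (y + c)).
      set (r := INR (S m)). simpl. ring. }
    rewrite Rmult_minus_distr_l.
    apply (is_derive_minus (V := R_NormedModule)); [now apply P | ].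
    apply is_derive_ext with (fun y => / (y + (INR k + s)) ^ m);
      [intros; now rewrite Rplus_assoc | ].
    rewrite Rplus_assoc. apply P. lra. }
  unfold gap_sum. induction N as [ | N IH].
  - rewrite sum_O. eapply is_derive_ext; [ | apply (Hk 0%nat)].
    intros t. now rewrite sum_O.
  - rewrite sum_Sn. unfold plus; simpl. rewrite Rmult_plus_distr_l.
    eapply is_derive_ext; [intros t; symmetry; apply sum_Sn | ].
    apply (is_derive_plus (V := R_NormedModule)); [exact IH | apply Hk].
Qed.

End GapSeries.

(** The errors depend on [n] alone, so the derivatives converge uniformly and the limit may be
    differentiated on a ball around each point. *)
Lemma is_derive_uniform_limit (f f' : nat -> R -> R) (g g' : R -> R) (e e' : nat -> R) :
  is_lim_seq e 0 -> is_lim_seq e' 0 ->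
  (forall n x, 0 < x -> is_derive (f n) x (f' n x)) ->
  (forall n x, 0 < x -> Rabs (g x - f n x) <= e n) ->
  (forall n x, 0 < x -> Rabs (g' x - f' n x) <= e' n) ->
  forall x, 0 < x -> is_derive g x (g' x).
Proof.
  intros He He' Hd Hf Hf' x Hx. apply is_derive_Reals.
  (* Radius [x] keeps the ball around [x] inside the positive half-line. *)
  assert (HB : forall y, Boule x (mkposreal x Hx) y -> 0 < y).
  { unfold Boule; simpl. intros y Hy. apply Rabs_def2 in Hy. lra. }
  apply (CVU_derivable f f' g g' x (mkposreal x Hx)).
  - intros eps Heps. apply is_lim_seq_spec in He'.
    destruct (He' (mkposreal eps Heps)) as [N HN]. exists N. intros n y Hn Hy.
    apply Rle_lt_trans with (1 := Hf' n y (HB y Hy)).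
    specialize (HN n Hn). simpl in HN. rewrite Rminus_0_r in HN.
    apply Rle_lt_trans with (2 := HN), Rle_abs.
  - intros y Hy. apply is_lim_seq_Reals.
    apply is_lim_seq_le_le with (fun n => g y - e n) (fun n => g y + e n).
    + intros n. generalize (Hf n y (HB y Hy)). intros H. apply Rabs_le_between in H. lra.
    + replace (Finite (g y)) with (Finite (g y - 0)) by (f_equal; ring).
      apply is_lim_seq_minus'; [apply is_lim_seq_const | exact He].
    + replace (Finite (g y)) with (Finite (g y + 0)) by (f_equal; ring).
      apply is_lim_seq_plus'; [apply is_lim_seq_const | exact He].
  - intros n y Hy. apply is_derive_Reals, Hd, HB, Hy.
  - unfold Boule; simpl. rewrite Rminus_diag, Rabs_R0. exact Hx.
Qed.

Lemma is_lim_seq_scal_inv_S (c : R) : is_lim_seq (fun N => c * / INR (S N)) 0.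
Proof.
  replace (Finite 0) with (Rbar_mult c 0) by (simpl; f_equal; ring).
  apply is_lim_seq_scal_l, is_lim_seq_inv_S.
Qed.

Lemma is_derive_gap_series (m : nat) (s y : R) :
  0 <= s <= 1 -> 0 < y ->
  is_derive (gap_series (S m) s) y (- INR (S m) * gap_series (S (S m)) s y).
Proof.
  intros Hs. revert y.
  apply (is_derive_uniform_limit
    (fun N => gap_sum (S m) s N) (fun N y => - INR (S m) * gap_sum (S (S m)) s N y)
    (gap_series (S m) s) (fun y => - INR (S m) * gap_series (S (S m)) s y)
    (fun N => / INR (S N)) (fun N => INR (S m) * / INR (S N))).
  - apply is_lim_seq_inv_S.
  - apply is_lim_seq_scal_inv_S.
  - intros N y Hy. now apply is_derive_gap_sum.
  - intros N y Hy. now apply gap_series_tail.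
  - intros N y Hy.
    rewrite <- Rmult_minus_distr_l, Rabs_mult, Rabs_Ropp, Rabs_pos_eq by apply pos_INR.
    apply Rmult_le_compat_l; [apply pos_INR | now apply gap_series_tail].
Qed.

(** * The logarithm of [Gamma (y + s) / Gamma y] and its derivative *)

Definition ln_Gamma_ratio (s y : R) : R := ln (Gamma (y + s)) - ln (Gamma y).

(** Wendel's inequality from [z] to [z + s] gives the upper bound. From [z + s] to [z + 1], with
    exponent [1 - s], it gives the lower one, at a loss of [s * (1 - s) / z] when [ln (z + s)] is
    replaced by [ln z + s / z]. *)
Lemma ln_Gamma_ratio_bound (s z : R) :
  0 <= s <= 1 -> 0 < z -> Rabs (ln_Gamma_ratio s z - s * ln z) <= / z.
Proof.
  intros Hs Hz. unfold ln_Gamma_ratio.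
  assert (G0 := Gamma_pos z Hz). assert (G1 := Gamma_pos (z + s) ltac:(lra)).
  assert (U : ln (Gamma (z + s)) <= s * ln z + ln (Gamma z)).
  { rewrite <- ln_Rpower, <- ln_mult by (trivial; apply exp_pos).
    apply ln_le; [exact G1 | ]. now apply Gamma_Wendel. }
  assert (L : ln z + ln (Gamma z) <= (1 - s) * ln (z + s) + ln (Gamma (z + s))).
  { rewrite <- ln_Rpower, <- !ln_mult by (trivial; apply exp_pos).
    rewrite <- Gamma_succ by exact Hz.
    apply ln_le; [apply Gamma_pos; lra | ].
    replace (z + 1) with (z + s + (1 - s)) by ring. apply Gamma_Wendel; lra. }
  assert (D : ln (z + s) <= ln z + s / z).
  { replace (z + s) with (z * ((z + s) / z)) by (field; lra).
    rewrite ln_mult by (try lra; apply Rdiv_lt_0_compat; lra).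
    assert (H := ln_le_sub_1 ((z + s) / z) ltac:(apply Rdiv_lt_0_compat; lra)).
    replace ((z + s) / z - 1) with (s / z) in H by (field; lra). lra. }
  assert (Hi : 0 < / z) by (apply Rinv_0_lt_compat; lra).
  apply Rabs_le. split; [ | lra].
  assert ((1 - s) * ln (z + s) <= (1 - s) * (ln z + s / z)) by (apply Rmult_le_compat_l; lra).
  assert ((1 - s) * (s / z) <= / z) by (unfold Rdiv; nra).
  lra.
Qed.

Definition ln_gap_sum (s : R) (N : nat) (y : R) : R :=
  sum_n (fun k => ln (y + INR k) - ln (y + INR k + s)) N.

(** Iterating [Gamma_succ] pushes the argument to infinity, where the ratio is known
    asymptotically. *)
Lemma ln_Gamma_ratio_shift (s y : R) (N : nat) :
  0 <= s -> 0 < y ->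
  ln_Gamma_ratio s y = ln_Gamma_ratio s (y + INR (S N)) + ln_gap_sum s N y.
Proof.
  intros Hs Hy.
  assert (Hstep : forall z, 0 < z ->
    ln_Gamma_ratio s z = ln_Gamma_ratio s (z + 1) + (ln z - ln (z + s))).
  { intros z Hz. unfold ln_Gamma_ratio.
    replace (z + 1 + s) with (z + s + 1) by ring.
    rewrite !Gamma_succ by lra.
    rewrite !ln_mult by (try lra; apply Gamma_pos; lra). ring. }
  unfold ln_gap_sum. induction N as [ | N IH].
  - rewrite sum_O. simpl INR. rewrite Rplus_0_r. now apply Hstep.
  - rewrite IH, sum_Sn. unfold plus; cbn [AbelianMonoid.plus].
    rewrite (Hstep (y + INR (S N))) by (generalize (pos_INR (S N)); lra).
    rewrite (S_INR (S N)), (Rplus_assoc y). simpl. ring.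
Qed.

Lemma is_derive_ln_gap_sum (s : R) (N : nat) (y : R) :
  0 <= s -> 0 < y -> is_derive (ln_gap_sum s N) y (gap_sum 1 s N y).
Proof.
  intros Hs Hy.
  assert (Hk : forall k, is_derive (fun y => ln (y + INR k) - ln (y + INR k + s)) y
    (inv_pow_gap 1 s (y + INR k))).
  { intros k. assert (H := pos_INR k). unfold inv_pow_gap.
    auto_derive; [split; [lra | split; [lra | trivial]] | field; lra]. }
  unfold gap_sum, ln_gap_sum. induction N as [ | N IH].
  - rewrite sum_O. eapply is_derive_ext; [ | apply (Hk 0%nat)].
    intros t. now rewrite sum_O.
  - rewrite sum_Sn. eapply is_derive_ext; [intros t; symmetry; apply sum_Sn | ].
    apply (is_derive_plus (V := R_NormedModule)); [exact IH | apply Hk].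
Qed.

(** Replacing the ratio at [y + INR (S N)] by [s * ln (y + INR (S N))] exhibits [ln_Gamma_ratio s]
    as a uniform limit of elementary functions; the Gamma integral itself is never
    differentiated. *)
Lemma is_derive_ln_Gamma_ratio (s y : R) :
  0 <= s <= 1 -> 0 < y -> is_derive (ln_Gamma_ratio s) y (gap_series 1 s y).
Proof.
  intros Hs. revert y.
  apply (is_derive_uniform_limit
    (fun N y => s * ln (y + INR (S N)) + ln_gap_sum s N y)
    (fun N y => s * / (y + INR (S N)) + gap_sum 1 s N y)
    (ln_Gamma_ratio s) (gap_series 1 s)
    (* In the derivative, one [/ INR (S N)] covers the tail of the series and the other covers
       [s * / (y + INR (S N))]. *)
    (fun N => / INR (S N)) (fun N => 2 * / INR (S N))).
  - apply is_lim_seq_inv_S.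
  - apply is_lim_seq_scal_inv_S.
  - intros N y Hy. assert (HN := pos_INR (S N)).
    apply (is_derive_plus (V := R_NormedModule)).
    + set (c := INR (S N)) in *. auto_derive; [lra | field; lra].
    + apply is_derive_ln_gap_sum; lra.
  - intros N y Hy. assert (HN := inv_pow_shift_le 0 N y Hy).
    rewrite (ln_Gamma_ratio_shift s y N) by lra.
    match goal with |- Rabs (?a + ?b - (?c + ?b)) <= _ =>
      replace (a + b - (c + b)) with (a - c) by ring end.
    apply Rle_trans with (/ (y + INR (S N))).
    + apply ln_Gamma_ratio_bound; [exact Hs | generalize (pos_INR (S N)); lra].
    + rewrite pow_1 in HN. apply HN.
  - intros N y Hy. assert (HN := inv_pow_shift_le 0 N y Hy). rewrite pow_1 in HN.
    assert (HT := gap_series_tail s Hs 0 N y Hy).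
    apply Rabs_le_between in HT. apply Rabs_le.
    assert (0 <= s * / (y + INR (S N)) <= / (y + INR (S N))) by nra.
    lra.
Qed.
(** * Completely monotone functions *)

(* Complete monotonicity up to order n, with the derivatives as witnesses: closure
   under products is then an induction, without Leibniz's formula. *)
Fixpoint cm_upto (I : R -> Prop) (n : nat) (f : R -> R) : Prop :=
  (forall x, I x -> 0 <= f x) /\
  match n with
  | O => True
  | S n => exists df, (forall x, I x -> is_derive f x (- df x)) /\ cm_upto I n df
  end.

(** Sign-free counterpart of [cm_upto]: the exponential of a function has to be smooth, but the sign
    conditions bear on its logarithm. *)
Fixpoint differentiable_upto (I : R -> Prop) (n : nat) (f : R -> R) : Prop :=
  match n with
  | O => True
  | S n => exists df, (forall x, I x -> is_derive f x (df x)) /\ differentiable_upto I n df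
  end.

Section Derivatives.

Variable I : R -> Prop.

Lemma cm_upto_S (n : nat) (f : R -> R) : cm_upto I (S n) f -> cm_upto I n f.
Proof.
  revert f. induction n as [ | n IH]; intros f [H (df & Hd & Hdf)]; split; trivial.
  exists df. split; [exact Hd | now apply IH].
Qed.

Lemma cm_upto_plus (n : nat) (f g : R -> R) :
  cm_upto I n f -> cm_upto I n g -> cm_upto I n (fun x => f x + g x).
Proof.
  revert f g. induction n as [ | n IH]; intros f g [Hf Df] [Hg Dg].
  - split; trivial. intros x Hx. now apply Rplus_le_le_0_compat; [apply Hf | apply Hg].
  - destruct Df as (df & Df & Cf), Dg as (dg & Dg & Cg). split.
    + intros x Hx. now apply Rplus_le_le_0_compat; [apply Hf | apply Hg].
    + exists (fun x => df x + dg x). split; [ | now apply IH].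
      intros x Hx. rewrite Ropp_plus_distr.
      apply (is_derive_plus (V := R_NormedModule)); auto.
Qed.

Lemma cm_upto_mult (n : nat) (f g : R -> R) :
  cm_upto I n f -> cm_upto I n g -> cm_upto I n (fun x => f x * g x).
Proof.
  revert f g. induction n as [ | n IH]; intros f g Cf Cg.
  - destruct Cf as [Hf _], Cg as [Hg _]. split; trivial.
    intros x Hx. now apply Rmult_le_pos; [apply Hf | apply Hg].
  - assert (Cf' := cm_upto_S _ _ Cf). assert (Cg' := cm_upto_S _ _ Cg).
    destruct Cf as [Hf (df & Df & Cf)], Cg as [Hg (dg & Dg & Cg)]. split.
    + intros x Hx. now apply Rmult_le_pos; [apply Hf | apply Hg].
    + exists (fun x => df x * g x + f x * dg x). split.
      * intros x Hx. evar_last.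
        { apply (is_derive_mult _ _ _ _ _ (Df x Hx) (Dg x Hx)). exact Rmult_comm. }
        unfold plus, mult; simpl. ring.
      * apply cm_upto_plus; now apply IH.
Qed.

(** An explicit sequence of signed derivatives supplies all witnesses at once; it serves both for
    [Derive_n] and for the quotient [F x / x]. *)
Lemma cm_upto_of_sequence (D : nat -> R -> R) :
  (forall n x, I x -> is_derive (D n) x (- D (S n) x)) ->
  (forall n x, I x -> 0 <= D n x) ->
  forall n k, cm_upto I n (D k).
Proof.
  intros Hd Hpos n. induction n as [ | n IH]; intros k.
  - split; auto.
  - split; [auto | ]. exists (D (S k)). auto.
Qed.

Lemma differentiable_upto_opp (n : nat) (f : R -> R) :
  differentiable_upto I n f -> differentiable_upto I n (fun x => - f x).
Proof.
  revert f. induction n as [ | n IH]; intros f H; [exact Logic.I | ].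
  destruct H as (df & Hd & H). exists (fun x => - df x). split; [ | now apply IH].
  intros x Hx. apply (is_derive_opp (V := R_NormedModule)). now apply Hd.
Qed.

Lemma differentiable_upto_of_cm_upto (n : nat) (f : R -> R) :
  cm_upto I n f -> differentiable_upto I n f.
Proof.
  revert f. induction n as [ | n IH]; intros f H; [exact Logic.I | ].
  destruct H as [_ (df & Hd & H)]. exists (fun x => - df x). split; [exact Hd | ].
  now apply differentiable_upto_opp, IH.
Qed.

Lemma differentiable_upto_S (n : nat) (f : R -> R) :
  differentiable_upto I (S n) f -> differentiable_upto I n f.
Proof.
  revert f. induction n as [ | n IH]; intros f H; [exact Logic.I | ].
  destruct H as (df & Hd & H). exists df. split; [exact Hd | now apply IH].
Qed.

Lemma differentiable_upto_plus (n : nat) (f g : R -> R) :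
  differentiable_upto I n f -> differentiable_upto I n g ->
  differentiable_upto I n (fun x => f x + g x).
Proof.
  revert f g. induction n as [ | n IH]; intros f g Hf Hg; [exact Logic.I | ].
  destruct Hf as (df & Df & Hf), Hg as (dg & Dg & Hg).
  exists (fun x => df x + dg x). split; [ | now apply IH].
  intros x Hx. apply (is_derive_plus (V := R_NormedModule)); auto.
Qed.

Lemma differentiable_upto_mult (n : nat) (f g : R -> R) :
  differentiable_upto I n f -> differentiable_upto I n g ->
  differentiable_upto I n (fun x => f x * g x).
Proof.
  revert f g. induction n as [ | n IH]; intros f g Hf Hg; [exact Logic.I | ].
  assert (Hf' := differentiable_upto_S _ _ Hf). assert (Hg' := differentiable_upto_S _ _ Hg).
  destruct Hf as (df & Df & Hf), Hg as (dg & Dg & Hg).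
  exists (fun x => df x * g x + f x * dg x). split.
  - intros x Hx. apply (is_derive_mult _ _ _ _ _ (Df x Hx) (Dg x Hx)). exact Rmult_comm.
  - apply differentiable_upto_plus; now apply IH.
Qed.

Lemma differentiable_upto_exp (n : nat) (f : R -> R) :
  differentiable_upto I n f -> differentiable_upto I n (fun x => exp (f x)).
Proof.
  induction n as [ | n IH]; intros Hf; [exact Logic.I | ].
  assert (Hf' := differentiable_upto_S _ _ Hf).
  destruct Hf as (df & Df & Hf).
  exists (fun x => df x * exp (f x)). split.
  - intros x Hx. apply (is_derive_comp exp f x (exp (f x)) (df x)); [ | now apply Df].
    apply is_derive_Reals, derivable_pt_lim_exp.
  - apply differentiable_upto_mult; auto.
Qed.

Hypothesis openI : open I.

(** [Derive_n] differentiates the last derivative again, whereas the witnesses peel off the first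
    one. Openness of [I] makes [df] agree with the derivative of [f] on a neighbourhood of [x]. *)
Lemma Derive_n_S_of_is_derive (n : nat) (f df : R -> R) (x : R) :
  (forall t, I t -> is_derive f t (df t)) -> I x ->
  Derive_n f (S n) x = Derive_n df n x.
Proof.
  intros Hd Hx. replace (S n) with (n + 1)%nat by lia.
  rewrite <- Derive_n_comp. apply Derive_n_ext_loc.
  generalize (openI x Hx). apply filter_imp. intros t Ht.
  apply is_derive_unique. now apply Hd.
Qed.

Lemma ex_derive_n_of_differentiable_upto (n : nat) (f : R -> R) (x : R) :
  differentiable_upto I n f -> I x -> ex_derive_n f n x.
Proof.
  revert f. induction n as [ | n IH]; intros f H Hx; [exact Logic.I | ].
  (* [ex_derive_n] is trivial at order 0, so the induction hypothesis says nothing about order 1;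
     there the witness itself is used. *)
  destruct H as (df & Hd & H). destruct n as [ | n].
  - exists (df x). now apply Hd.
  - apply ex_derive_ext_loc with (Derive_n df n); [ | now apply IH].
    generalize (openI x Hx). apply filter_imp. intros t Ht. symmetry.
    now apply Derive_n_S_of_is_derive.
Qed.

Lemma Derive_n_sign_of_cm_upto (n : nat) (f : R -> R) (x : R) :
  cm_upto I n f -> I x -> 0 <= (-1) ^ n * Derive_n f n x.
Proof.
  revert f. induction n as [ | n IH]; intros f H Hx.
  - simpl. rewrite Rmult_1_l. destruct H as [H _]. now apply H.
  - destruct H as [_ (df & Hd & H)].
    rewrite (Derive_n_S_of_is_derive n f (fun t => - df t)), Derive_n_opp by assumption.
    simpl. replace (-1 * (-1) ^ n * - Derive_n df n x) with ((-1) ^ n * Derive_n df n x)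
      by ring. now apply IH.
Qed.

Lemma cm_upto_of_completely_monotone_on (n : nat) (f : R -> R) :
  completely_monotone_on I f -> cm_upto I n f.
Proof.
  intros [Hs Hpos].
  assert (H : forall k, cm_upto I n (fun x => (-1) ^ k * Derive_n f k x)).
  { apply (cm_upto_of_sequence (fun k x => (-1) ^ k * Derive_n f k x)).
    - intros k x Hx. simpl.
      replace (- (-1 * (-1) ^ k * Derive (Derive_n f k) x))
        with ((-1) ^ k * Derive (Derive_n f k) x) by ring.
      apply is_derive_scal, Derive_correct. apply (Hs (S k) x Hx).
    - intros k x Hx. now apply Hpos. }
  (* At index 0 the sequence is [1 * f x]; the factor is removed at the top level of [cm_upto] only,
     and the witness below is kept. *)
  specialize (H 0%nat). simpl in H.
  clear Hs Hpos. destruct n as [ | n]; destruct H as [H0 H1]; split; trivial.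
  - intros x Hx. generalize (H0 x Hx). now rewrite Rmult_1_l.
  - intros x Hx. generalize (H0 x Hx). now rewrite Rmult_1_l.
  - destruct H1 as (df & Hd & H1). exists df. split; [ | exact H1].
    intros x Hx. eapply is_derive_ext; [ | now apply Hd].
    intros t. apply Rmult_1_l.
Qed.

Lemma log_completely_monotone_on_exp (f : R -> R) :
  (forall n, cm_upto I n f) -> log_completely_monotone_on I (fun x => exp (f x)).
Proof.
  intros Hf. split; [ | split].
  - intros x _. apply exp_pos.
  - intros n x Hx. apply ex_derive_n_of_differentiable_upto; trivial.
    apply differentiable_upto_exp, differentiable_upto_of_cm_upto, Hf.
  - intros n x _ Hx.
    rewrite (Derive_n_ext (fun t => ln (exp (f t))) f) by (intros; apply ln_exp).
    now apply Derive_n_sign_of_cm_upto.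
Qed.

End Derivatives.

(** * Division by the identity *)

(* [n! * (Taylor polynomial of F of order n at x, evaluated at 0)], and also
   [(-1) ^ n * x ^ (n+1) * (F x / x) ^ (n)], when [D n = (-1) ^ n * F ^ (n+1)]. *)
Fixpoint div_id_numerator (F : R -> R) (D : nat -> R -> R) (n : nat) (x : R) : R :=
  match n with
  | O => F x
  | S k => INR (S k) * div_id_numerator F D k x - x ^ S k * D k x
  end.

Section DivId.

Variables (F : R -> R) (D : nat -> R -> R).
Hypothesis F_derive : forall x, 0 <= x -> is_derive F x (D O x).
Hypothesis D_derive : forall n x, 0 <= x -> is_derive (D n) x (- D (S n) x).
Hypothesis D_ge_0 : forall n x, 0 <= x -> 0 <= D n x.
Hypothesis F_0 : 0 <= F 0.

(** In the step to [S n], the two terms [INR (S n) * x ^ n * D n x] cancel, and only the term from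
    the derivative of [D n] survives. *)
Lemma is_derive_div_id_numerator (n : nat) (x : R) :
  0 <= x -> is_derive (div_id_numerator F D n) x (x ^ n * D n x).
Proof.
  intros Hx. induction n as [ | n IH].
  - simpl. rewrite Rmult_1_l. now apply F_derive.
  - apply (is_derive_scal _ _ (INR (S n))) in IH.
    assert (Hp : is_derive (fun t => t ^ S n) x (INR (S n) * 1 * x ^ n)).
    { apply (is_derive_pow (fun t => t) (S n)), (is_derive_id (K := R_AbsRing)). }
    assert (Hm := is_derive_mult _ _ _ _ _ Hp (D_derive n x Hx) Rmult_comm).
    assert (H := is_derive_minus (V := R_NormedModule) _ _ _ _ _ IH Hm).
    evar_last; [exact H | ].
    unfold minus, plus, opp, mult; cbn -[INR pow]. simpl pow. ring.
Qed.

Lemma div_id_numerator_ge_0 (n : nat) (x : R) : 0 <= x -> 0 <= div_id_numerator F D n x.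
Proof.
  intros Hx.
  assert (H0 : 0 <= div_id_numerator F D n 0).
  { induction n as [ | n IH]; [exact F_0 | ].
    cbn [div_id_numerator]. rewrite pow_i, Rmult_0_l, Rminus_0_r by lia.
    apply Rmult_le_pos; [apply pos_INR | exact IH]. }
  destruct (MVT_gen (div_id_numerator F D n) 0 x (fun t => t ^ n * D n t)) as (c & Hc & E).
  - rewrite Rmin_left by exact Hx. intros t Ht. apply is_derive_div_id_numerator; lra.
  - rewrite Rmin_left by exact Hx. intros t Ht. apply derivable_continuous_pt.
    eexists. apply is_derive_Reals, is_derive_div_id_numerator; lra.
  - rewrite Rmin_left in Hc by exact Hx.
    assert (0 <= c ^ n * D n c * (x - 0)); [ | lra].
    apply Rmult_le_pos; [ | lra].
    apply Rmult_le_pos; [apply pow_le | apply D_ge_0]; lra.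
Qed.

(** Writing [/ x ^ 1] makes the quotient the term of index 0 in a sequence with denominators
    [x ^ S n]. *)
Lemma cm_upto_div_id (n : nat) : cm_upto (fun x => 0 < x) n (fun x => F x * / x ^ 1).
Proof.
  apply (cm_upto_of_sequence _ (fun n x => div_id_numerator F D n x * / x ^ S n)) with (k := O).
  - intros k x Hx.
    assert (Hi : is_derive (fun t => / t ^ S k) x (- (INR (S k) * 1 * x ^ k) / (x ^ S k) ^ 2)).
    { apply is_derive_inv; [ | apply pow_nonzero; lra].
      apply (is_derive_pow (fun t => t) (S k)), (is_derive_id (K := R_AbsRing)). }
    assert (Hn := is_derive_div_id_numerator k x ltac:(lra)).
    evar_last; [exact (is_derive_mult _ _ _ _ _ Hn Hi Rmult_comm) | ].
    unfold plus, mult; cbn -[INR pow]. simpl pow. field.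
    split; [apply pow_nonzero; lra | lra].
  - intros k x Hx. apply Rmult_le_pos; [apply div_id_numerator_ge_0; lra | ].
    left. apply Rinv_0_lt_compat, pow_lt, Hx.
Qed.

End DivId.

(** * Signed derivatives of F and the conclusion *)

(** At [y = x + a] with [s = b - a], this is [(-1)^n F^(n+1)(x)]. *)
Definition gap_minus_inv (s beta : R) (n : nat) (y : R) : R :=
  INR (fact n) * (gap_series (S n) s y - beta * / y ^ S n).

Lemma gap_minus_inv_ge_0 (s beta : R) (n : nat) (y : R) :
  0 <= s <= 1 -> beta <= s -> 0 < y -> 0 <= gap_minus_inv s beta n y.
Proof.
  intros Hs Hb Hy. apply Rmult_le_pos; [apply pos_INR | ].
  assert (H := gap_series_lower s Hs n y Hy).
  assert (0 < / y ^ S n) by (apply Rinv_0_lt_compat, pow_lt, Hy).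
  assert (beta * / y ^ S n <= s * / y ^ S n) by (apply Rmult_le_compat_r; lra).
  lra.
Qed.

Lemma is_derive_gap_minus_inv (s beta : R) (n : nat) (y : R) :
  0 <= s <= 1 -> 0 < y ->
  is_derive (gap_minus_inv s beta n) y (- gap_minus_inv s beta (S n) y).
Proof.
  intros Hs Hy. unfold gap_minus_inv.
  assert (Hi : is_derive (fun t => / t ^ S n) y (- (INR (S n) * 1 * y ^ n) / (y ^ S n) ^ 2)).
  { apply is_derive_inv; [ | apply pow_nonzero; lra].
    apply (is_derive_pow (fun t => t) (S n)), (is_derive_id (K := R_AbsRing)). }
  apply (is_derive_scal _ _ beta) in Hi.
  assert (H := is_derive_minus (V := R_NormedModule) _ _ _ _ _
    (is_derive_gap_series n s y Hs Hy) Hi).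
  apply (is_derive_scal _ _ (INR (fact n))) in H.
  evar_last; [exact H | ].
  rewrite fact_simpl, mult_INR.
  unfold minus, plus, opp, mult; cbn -[INR pow gap_series fact]. simpl pow. field.
  split; [apply pow_nonzero; lra | lra].
Qed.

Theorem theorem2p20 :
  forall (a b beta c0 : R) (g : R -> R),
    0 < a -> 0 < b ->
    0 < 1 - b + a <= 1 ->
    beta <= b - a ->
    Rpower a beta * Gamma a / Gamma b <= c0 ->
    completely_monotone_on (fun x : R => 0 < x) g ->
    log_completely_monotone_on (fun x : R => 0 < x)
      (fun x : R =>
         Rpower (c0 * Gamma (x + b) / (Rpower (x + a) beta * Gamma (x + a)))
                (g x / x)).
Proof.
  intros a b beta c0 g Ha Hb Hab Hbeta Hc0 Hg.
  set (s := b - a).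
  assert (Hs : 0 <= s <= 1) by (unfold s; lra).
  assert (Ga := Gamma_pos a Ha). assert (Gb := Gamma_pos b Hb).
  assert (Hpa : 0 < Rpower a beta) by apply exp_pos.
  (* The lower bound on [c0] is itself positive; this allows [ln c0] to be split off. *)
  assert (Hc : 0 < c0).
  { apply Rlt_le_trans with (2 := Hc0). apply Rdiv_lt_0_compat; trivial.
    now apply Rmult_lt_0_compat. }
  set (F := fun x => ln (c0 * Gamma (x + b) / (Rpower (x + a) beta * Gamma (x + a)))).
  (* The range [x > -a] contains a neighbourhood of 0, where F must have a two-sided derivative. *)
  assert (EF : forall x, 0 < x + a ->
    F x = ln_Gamma_ratio s (x + a) + (- beta) * ln (x + a) + ln c0).
  { intros x Hx. unfold F, ln_Gamma_ratio.
    assert (G1 := Gamma_pos (x + a) Hx).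
    assert (G2 := Gamma_pos (x + b) ltac:(unfold s in Hs; lra)).
    assert (Hp : 0 < Rpower (x + a) beta) by apply exp_pos.
    rewrite ln_div, !ln_mult, ln_Rpower by (try apply Rmult_lt_0_compat; trivial).
    replace (x + a + s) with (x + b) by (unfold s; ring). ring. }
  (* [Rpower u v] unfolds to [exp (v * ln u)], so the function already has the form [exp (f x)]. *)
  apply log_completely_monotone_on_exp with (f := fun x => g x / x * F x);
    [apply open_gt | ].
  intros n.
  assert (HF : cm_upto (fun x => 0 < x) n (fun x => F x * / x ^ 1)).
  { apply cm_upto_div_id with (D := fun n x => gap_minus_inv s beta n (x + a)).
    - intros x Hx.
      apply is_derive_ext_loc with
        (fun x => ln_Gamma_ratio s (x + a) + (- beta) * ln (x + a) + ln c0).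
      + generalize (open_gt (- a) x ltac:(lra)). apply filter_imp.
        intros t Ht. symmetry. apply EF. lra.
      + assert (H1 := is_derive_ln_Gamma_ratio s (x + a) Hs ltac:(lra)).
        assert (H2 : is_derive (fun x => x + a) x 1) by (auto_derive; trivial).
        assert (H3 := is_derive_comp _ _ _ _ _ H1 H2).
        assert (H4 : is_derive (fun x => (- beta) * ln (x + a) + ln c0) x
          (- beta * / (x + a))) by (auto_derive; [lra | field; lra]).
        assert (H5 := is_derive_plus (V := R_NormedModule) _ _ _ _ _ H3 H4).
        eapply is_derive_ext; [ | evar_last; [exact H5 | ]].
        * intros t. unfold plus; simpl. ring.
        * unfold gap_minus_inv, plus, scal; simpl. unfold mult; simpl. field. lra.
    - intros k x Hx.
      assert (H1 := is_derive_gap_minus_inv s beta k (x + a) Hs ltac:(lra)).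
      assert (H2 : is_derive (fun x => x + a) x 1) by (auto_derive; trivial).
      evar_last; [exact (is_derive_comp _ _ _ _ _ H1 H2) | ].
      unfold scal; simpl. unfold mult; simpl. ring.
    - intros k x Hx. apply gap_minus_inv_ge_0; unfold s in *; lra.
    (* [F 0 >= 0] says that the bracket at 0 is at least 1, which is the bound on [c0]
       rearranged. *)
    - unfold F. rewrite !Rplus_0_l. rewrite <- ln_1. apply ln_le; [lra | ].
      apply Rmult_le_reg_r with (Rpower a beta * Gamma a / Gamma b).
      + apply Rdiv_lt_0_compat; [now apply Rmult_lt_0_compat | exact Gb].
      + rewrite Rmult_1_l. apply Rle_trans with (1 := Hc0). right. field. lra. }
  assert (Hgn := cm_upto_of_completely_monotone_on _ n g Hg).
  generalize (cm_upto_mult _ n _ _ Hgn HF).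
  assert (E : (fun x => g x * (F x * / x ^ 1)) = (fun x => g x / x * F x)).
  { apply FunctionalExtensionality.functional_extensionality. intros x.
    rewrite pow_1. unfold Rdiv. ring. }
  now rewrite E.
Qed.
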